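(* Let $\mathcal R$ be the tautological bundle over the orthogonal Grassmannian $OG(n,2n+1)$, and let $\phi(\mathcal R)$ be the characteristic class of $\mathcal R$ given by a symmetric polynomial $V$ in $n$ variables evaluated at the Chern roots of $\mathcal R$. Then $$\int_{OG(n,2n+1)}\phi(\mathcal R)=\mathrm{Res}_{\mathbf z=\infty}\ \frac1{n!}\,\frac{V(z_1,\dots,z_n)\prod_{i\ne j}(z_j-z_i)\prod_{i<j}(z_i+z_j)\,2^n}{\prod_{i=1}^n\prod_{j=1}^n(t_i-z_j)(t_i+z_j)},$$ where $\prod_{i\ne j}$ runs over ordered pairs of distinct indices in $\{1,\dots,n\}$ and $\prod_{i<j}$ over $1\le i<j\le n$.
   Context: $OG(n,2n+1)$ is the variety of $n$-dimensional isotropic subspaces of $\mathbb C^{2n+1}$ with a nondegenerate symmetric bilinear form, where $\mathbb C^{2n+1}$ has a basis $q_1,\dots,q_n,p_1,\dots,p_n,r$ with $q_i$ dual to $p_i$, $r$ of nonzero norm, and all other pairings zero. The torus $\mathbb T=(\mathbb C^* )^n$ of diagonal matrices acts on it; $t_1,\dots,t_n$ are the characters of the torus. The integral is the push-forward in $\mathbb T$-equivariant cohomology $H^*_{\mathbb T}(OG(n,2n+1))\to H^*_{\mathbb T}(pt)$. Conventions: the fixed points are $p_I=\mathrm{Span}\{q_i,p_j: i\in I,\ j\notin I\}$ for all subsets $I\subseteq\{1,\dots,n\}$. At $p_I$ the class $\phi(\mathcal R)$ restricts to $V(t_i,-t_j: i\in I, j\notin I)$, and the weights of the torus action on the tangent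 space at $p_I$ are taken to be $\{\pm t_i\pm t_j:1\le i<j\le n\}\cup\{\pm t_i:1\le i\le n\}$, where $t_i$ carries the sign $+$ if $i\in I$ and $-$ if $i\notin I$. With this convention the Berline–Vergne localization formula expresses the integral as the sum over $I$ of $V(t_i,-t_j: i\in I, j\notin I)$ divided by the product of these weights. Iterated residue at infinity: for a function $f(\mathbf z)$, $\mathbf z=(z_1,\dots,z_n)$, that is a quotient of a holomorphic function by a product of affine forms, $\mathrm{Res}_{\mathbf z=\infty}f=\mathrm{Res}_{z_1=\infty}\cdots\mathrm{Res}_{z_n=\infty}f\,d\mathbf z:=\left(\frac1{2\pi i}\right)^n\int_{|z_1|=R_1}\cdots\int_{|z_n|=R_n}f\,d\mathbf z$ with $1\ll R_1\ll\dots\ll R_n$, the circles being oriented so that in one variable the residue at infinity is minus the sum of the residues at all finite poles. The $t_i$ are treated as generic constants. *)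

(* Defs.v *)
From HB Require Import structures.
From mathcomp Require Import all_boot all_order all_algebra.
From mathcomp Require Import all_classical all_reals all_analysis.
From mathcomp Require Import complex.
(* The notations of mpoly are incompatible with those of mathcomp-analysis.
   [mpoly n K] is {mpoly K[n]} and [meval v V] is V.@[v]. *)
From mathcomp Require Import -(notations) mpoly.

Set Implicit Arguments.
Unset Strict Implicit.
Unset Printing Implicit Defensive.

Import Order.TTheory GRing.Theory Num.Theory numFieldNormedType.Exports.

Local Open Scope classical_set_scope.
Local Open Scope ring_scope.
Local Open Scope complex_scope.

(** * The orthogonal Grassmannian OG(n, 2n+1) *)

(* Coordinates 0..n-1 are the q_i, n..2n-1 the p_i, and 2n is r. *)
Definition q_idx (n : nat) (i : 'I_n) : 'I_(n + n + 1) := lshift 1 (lshift n i).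
Definition p_idx (n : nat) (i : 'I_n) : 'I_(n + n + 1) := lshift 1 (rshift n i).
Definition r_idx (n : nat) : 'I_(n + n + 1) := rshift (n + n) ord0.

Definition q_vec (R : realType) (n : nat) (i : 'I_n) : 'rV[R[i]]_(n + n + 1) :=
  delta_mx 0 (q_idx i).

(* [rho] is the norm of r. *)
Definition form (R : realType) (n : nat) (rho : R[i])
    (u v : 'rV[R[i]]_(n + n + 1)) : R[i] :=
  \sum_(i < n) (u 0 (q_idx i) * v 0 (p_idx i) + u 0 (p_idx i) * v 0 (q_idx i))
  + rho * (u 0 (r_idx n) * v 0 (r_idx n)).

Definition OG (R : realType) (n : nat) (rho : R[i]) :
    set {vspace 'rV[R[i]]_(n + n + 1)} :=
  [set W | \dim W = n /\
           forall u v, u \in W -> v \in W -> form rho u v = 0].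

(* The element s of (C^* )^n scales q_i by s_i, p_i by s_i^-1, and fixes r. *)
Definition torus_mx (R : realType) (n : nat) (s : 'I_n -> R[i]) :
    'M[R[i]]_(n + n + 1) :=
  diag_mx (row_mx (row_mx (\row_i s i) (\row_i (s i)^-1)) (const_mx 1)).

Definition torus_fixed (R : realType) (n : nat)
    (W : {vspace 'rV[R[i]]_(n + n + 1)}) : Prop :=
  forall s : 'I_n -> R[i], (forall i, s i != 0) ->
    (linfun (mulmxr (torus_mx s)) @: W)%VS = W.

(** * Equivariant push-forward by localization

  An element of H_T(pt) = C[t_1, ..., t_n] is recorded by its value at the
  constants t_1, ..., t_n, and a class in H_T(OG(n,2n+1)) by its restrictions
  to the torus-fixed points. *)

(* The signed characters: at W = p_I the i-th root is t_i if i is in I (that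
   is, q_i is in W) and - t_i otherwise (p_i is in W). *)
Definition chern_root (R : realType) (n : nat) (t : 'I_n -> R[i])
    (W : {vspace 'rV[R[i]]_(n + n + 1)}) (i : 'I_n) : R[i] :=
  if q_vec R i \in W then t i else - t i.

Definition char_class (R : realType) (n : nat) (V : mpoly n R[i])
    (t : 'I_n -> R[i]) (W : {vspace 'rV[R[i]]_(n + n + 1)}) : R[i] :=
  meval (chern_root t W) V.

(* Product of the tangent weights at W, with the sign convention under which
   they are the sums of pairs of roots of the tautological bundle together
   with these roots themselves. *)
Definition euler_class (R : realType) (n : nat) (t : 'I_n -> R[i])
    (W : {vspace 'rV[R[i]]_(n + n + 1)}) : R[i] :=
  (\prod_(i < n) \prod_(j < n | (i < j)%N)
     (chern_root t W i + chern_root t W j))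
  * \prod_(i < n) chern_root t W i.

Definition OG_integral (R : realType) (n : nat) (rho : R[i])
    (t : 'I_n -> R[i]) (c : {vspace 'rV[R[i]]_(n + n + 1)} -> R[i]) : R[i] :=
  \sum_(W \in @OG R n rho `&` [set W | torus_fixed W]) (c W / euler_class t W).

(* No tangent weight vanishes at any fixed point. *)
Definition generic (R : realType) (n : nat) (t : 'I_n -> R[i]) : Prop :=
  (forall i, t i != 0) /\
  (forall i j, i != j -> t i != t j /\ t i != - t j).

(** * Iterated residue at infinity *)

Definition complex_integral (R : realType) (a b : R) (g : R -> R[i]) : R[i] :=
  (\int[lebesgue_measure]_(x in `[a, b]) complex.Re (g x)) +i*
  (\int[lebesgue_measure]_(x in `[a, b]) complex.Im (g x)).

(* The path th |-> r e^{-i th}, th in [0, 2 pi], is clockwise, so that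
   (2 pi i)^-1 times the integral is minus the sum of the finite residues;
   its derivative is r (- sin th - i cos th). *)
Definition circle_path (R : realType) (r th : R) : R[i] :=
  (r * cos th) +i* (- (r * sin th)).

Definition circle_path' (R : realType) (r th : R) : R[i] :=
  (- (r * sin th)) +i* (- (r * cos th)).

Definition circle_integral (R : realType) (r : R) (f : R[i] -> R[i]) : R[i] :=
  complex_integral 0 (2 * pi)
    (fun th => f (circle_path r th) * circle_path' r th).

(* The integral over z_1 is the outermost one. *)
Fixpoint iterated_integral (R : realType) (n : nat) :
    n.-tuple R -> (n.-tuple R[i] -> R[i]) -> R[i] :=
  match n return n.-tuple R -> (n.-tuple R[i] -> R[i]) -> R[i] with
  | 0 => fun _ f => f [tuple]
  | m.+1 => fun rs f =>
      circle_integral (thead rs) (fun z =>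
        iterated_integral [tuple of behead rs] (fun zs => f [tuple of z :: zs]))
  end.

(* [P] holds for 1 << R_1 << ... << R_n: each radius is taken large enough,
   depending on the previous ones. *)
Fixpoint for_large_radii (R : realType) (n : nat) : (n.-tuple R -> Prop) -> Prop :=
  match n return (n.-tuple R -> Prop) -> Prop with
  | 0 => fun P => P [tuple]
  | m.+1 => fun P =>
      \forall r \near +oo, for_large_radii (fun rs : m.-tuple R => P [tuple of r :: rs])
  end.

(* The iterated residue Res_{z_1 = oo} ... Res_{z_n = oo} f exists and is [v]. *)
Definition is_residue_at_infinity (R : realType) (n : nat)
    (f : ('I_n -> R[i]) -> R[i]) (v : R[i]) : Prop :=
  for_large_radii (fun rs : n.-tuple R =>
    (0 +i* (2 * pi)) ^- n
      * iterated_integral rs (fun z => f (fun j => tnth z j)) = v).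

(* Main.v *)
Require Import Defs.
From HB Require Import structures.
From mathcomp Require Import all_boot all_order all_algebra.
From mathcomp Require Import all_classical all_reals all_analysis.
From mathcomp Require Import complex.
From mathcomp Require Import -(notations) mpoly.
From mathcomp Require Import fingroup perm.
From mathcomp Require Import ring.

Set Implicit Arguments.
Unset Strict Implicit.
Unset Printing Implicit Defensive.

Import Order.TTheory GRing.Theory Num.Theory numFieldNormedType.Exports.
Import ComplexField.Normc.

Local Open Scope ring_scope.
Local Open Scope complex_scope.

(** The poles of the integrand lie on z_j = ± t_i, one variable at a time, so
    the iterated residue is a finite sum over all functions
    j |-> (i, sign).  The factors z_j - z_i and z_j + z_i kill every function
    whose first component is not a permutation, and the n! permutations with a
    given choice of signs contribute equally because V is symmetric.  At
    u_i = ± t_i the identity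
    prod_{i != k} (t_i^2 - t_k^2) = prod_{i != k} (u_i - u_k) (prod_{i < j} (u_i + u_j))^2
    turns the residue into V(u) / (prod_{i < j} (u_i + u_j) prod_i u_i), the
    localization term of the fixed point with these signs.  The fixed points are
    coordinate subspaces since the torus separates the coordinates; isotropy
    excludes r and one of each q_i, p_i. *)

(** * Integrals of complex-valued functions *)

Section ContinuousComplexIntegrands.
Variable R : realType.
Implicit Types (f g : R -> R[i]) (h k : R -> R) (a b : R).

Lemma continuous_add h k : continuous h -> continuous k ->
  continuous (fun x => h x + k x).
Proof. by move=> ch ck x; exact: (continuousD (ch x) (ck x)). Qed.

Lemma continuous_opp h : continuous h -> continuous (fun x => - h x).
Proof. by move=> ch x; exact: (continuousN (ch x)). Qed.

Lemma continuous_mul h k : continuous h -> continuous k ->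
  continuous (fun x => h x * k x).
Proof. by move=> ch ck x; exact: (continuousM (ch x) (ck x)). Qed.

(** Continuity is stated on real and imaginary parts because [complex_integral] is defined through
    them; integrability on a segment and the fundamental theorem then apply to each part. *)
Definition continuousC f : Prop :=
  continuous (fun x => complex.Re (f x) : R) /\
  continuous (fun x => complex.Im (f x) : R).

Lemma continuousC_cst (c : R[i]) : continuousC (fun=> c).
Proof. by split; apply: cst_continuous. Qed.

Lemma continuousCD f g : continuousC f -> continuousC g ->
  continuousC (fun x => f x + g x).
Proof.
move=> [f1 f2] [g1 g2]; split.
  rewrite (_ : (fun _ => _) = (fun x => complex.Re (f x) + complex.Re (g x))).
    exact: continuous_add.
  by apply/funext => x; case: (f x) (g x) => [? ?] [? ?].
rewrite (_ : (fun _ => _) = (fun x => complex.Im (f x) + complex.Im (g x))).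
  exact: continuous_add.
by apply/funext => x; case: (f x) (g x) => [? ?] [? ?].
Qed.

Lemma continuousCM f g : continuousC f -> continuousC g ->
  continuousC (fun x => f x * g x).
Proof.
move=> [f1 f2] [g1 g2]; split.
  rewrite (_ : (fun _ => _) = (fun x => complex.Re (f x) * complex.Re (g x)
     + - (complex.Im (f x) * complex.Im (g x)))).
    by apply: continuous_add; [|apply: continuous_opp]; exact: continuous_mul.
  by apply/funext => x; case: (f x) (g x) => [? ?] [? ?].
rewrite (_ : (fun _ => _) = (fun x => complex.Re (f x) * complex.Im (g x)
     + complex.Im (f x) * complex.Re (g x))).
  by apply: continuous_add; exact: continuous_mul.
by apply/funext => x; case: (f x) (g x) => [? ?] [? ?].
Qed.

(** The inverse is the conjugate divided by the squared modulus, which is continuous and never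
    zero. *)
Lemma continuousCV f : (forall x, f x != 0) -> continuousC f ->
  continuousC (fun x => (f x)^-1).
Proof.
move=> f0 [f1 f2].
have n0 x : complex.Re (f x) ^+ 2 + complex.Im (f x) ^+ 2 != 0.
  move: (f0 x); case: (f x) => u v /=; rewrite eq_complex /= negb_and.
  apply: contraTneq => /eqP; rewrite paddr_eq0 ?sqr_ge0// !sqrf_eq0.
  by rewrite negb_or !negbK.
have cn : continuous (fun x =>
    (complex.Re (f x) ^+ 2 + complex.Im (f x) ^+ 2)^-1 : R).
  move=> x; apply: (@continuousV _ _
    (fun y => complex.Re (f y) ^+ 2 + complex.Im (f y) ^+ 2)); first exact: n0.
  by apply: (continuous_add (h := fun y => complex.Re (f y) ^+ 2)
    (k := fun y => complex.Im (f y) ^+ 2)); exact: continuous_mul.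
split.
  rewrite (_ : (fun _ => _) = (fun x => complex.Re (f x) *
    (complex.Re (f x) ^+ 2 + complex.Im (f x) ^+ 2)^-1)).
    exact: continuous_mul.
  by apply/funext => x; case: (f x).
rewrite (_ : (fun _ => _) = (fun x => - (complex.Im (f x) *
    (complex.Re (f x) ^+ 2 + complex.Im (f x) ^+ 2)^-1))).
  by apply: continuous_opp; exact: continuous_mul.
by apply/funext => x; case: (f x) => u v /=; ring.
Qed.

Lemma continuousCX f n : continuousC f -> continuousC (fun x => f x ^+ n).
Proof.
move=> cf; elim: n => [|n IH].
  by under eq_fun do rewrite expr0; exact: continuousC_cst.
by under eq_fun do rewrite exprS; exact: continuousCM.
Qed.

Lemma continuousC_sum (I : Type) (r : seq I) (F : I -> R -> R[i]) :
  (forall i, continuousC (F i)) -> continuousC (fun x => \sum_(i <- r) F i x).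
Proof.
move=> cF; elim: r => [|i r IH].
  rewrite (_ : (fun _ => _) = (fun=> 0)); first exact: continuousC_cst.
  by apply/funext => x; rewrite big_nil.
rewrite (_ : (fun _ => _) = (fun x => F i x + \sum_(j <- r) F j x)).
  exact: continuousCD.
by apply/funext => x; rewrite big_cons.
Qed.

Lemma integrable_continuous (h : R -> R) a b : continuous h ->
  (@lebesgue_measure R).-integrable `[a, b]%classic (EFin \o h).
Proof.
move=> ch; apply: continuous_compact_integrable; first exact: segment_compact.
exact: continuous_subspaceT.
Qed.

Lemma complex_integralD a b f g : continuousC f -> continuousC g ->
  complex_integral a b (fun x => f x + g x) =
  complex_integral a b f + complex_integral a b g.
Proof.
move=> [f1 f2] [g1 g2]; rewrite /complex_integral.
apply/eqP; rewrite eq_complex /=; apply/andP; split; apply/eqP.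
  rewrite -RintegralD//; [|exact: integrable_continuous..].
  by apply: eq_Rintegral => x _; case: (f x) (g x) => [? ?] [? ?].
rewrite -RintegralD//; [|exact: integrable_continuous..].
by apply: eq_Rintegral => x _; case: (f x) (g x) => [? ?] [? ?].
Qed.

Lemma complex_integralZ a b (c : R[i]) f : continuousC f ->
  complex_integral a b (fun x => c * f x) = c * complex_integral a b f.
Proof.
case: c => u v [f1 f2]; rewrite /complex_integral.
apply/eqP; rewrite eq_complex /=; apply/andP; split; apply/eqP.
  rewrite -!RintegralZl//; [|exact: integrable_continuous..].
  rewrite -RintegralB//;
    [|apply: integrable_continuous; apply: continuous_mul => //; exact: cst_continuous..].
  by apply: eq_Rintegral => x _; case: (f x).
rewrite -!RintegralZl//; [|exact: integrable_continuous..].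
rewrite -RintegralD//;
  [|apply: integrable_continuous; apply: continuous_mul => //; exact: cst_continuous..].
by apply: eq_Rintegral => x _; case: (f x).
Qed.

Lemma complex_integral0 a b : complex_integral a b (fun=> 0) = 0 :> R[i].
Proof.
have := @complex_integralZ a b 0 (fun=> 0) (continuousC_cst 0).
by rewrite !mul0r.
Qed.

Lemma complex_integral_sum a b (I : Type) (r : seq I) (F : I -> R -> R[i]) :
  (forall i, continuousC (F i)) ->
  complex_integral a b (fun x => \sum_(i <- r) F i x) =
  \sum_(i <- r) complex_integral a b (F i).
Proof.
move=> cF; elim: r => [|i r IH].
  rewrite big_nil -[RHS](complex_integral0 a b); congr complex_integral.
  by apply/funext => x; rewrite big_nil.
rewrite big_cons -IH -complex_integralD//; last exact: continuousC_sum.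
by congr complex_integral; apply/funext => x; rewrite big_cons.
Qed.

Lemma normc_le_ReIm (z : R[i]) :
  normc z <= `|complex.Re z| + `|complex.Im z|.
Proof.
case: z => x y /=.
rewrite -[leRHS]ger0_norm ?addr_ge0// -sqrtr_sqr ler_sqrt ?sqr_ge0//.
rewrite sqrrD !real_normK ?num_real// addrAC lerDl.
by rewrite mulrn_wge0// mulr_ge0.
Qed.

Lemma ReIm_le_normc (z : R[i]) :
  `|complex.Re z| <= normc z /\ `|complex.Im z| <= normc z.
Proof.
case: z => x y /=; rewrite -!sqrtr_sqr !ler_wsqrtr//.
  by rewrite lerDr sqr_ge0.
by rewrite lerDl sqr_ge0.
Qed.

Lemma Rintegral_le_bound (h : R -> R) a b (M : R) : a <= b -> continuous h ->
  (forall x, `|h x| <= M) ->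
  `|\int[lebesgue_measure]_(x in `[a, b]) h x| <= M * (b - a).
Proof.
move=> ab ch hM; have ih := @integrable_continuous h a b ch.
apply: le_trans (le_normr_Rintegral _ ih) _ => //.
have -> : M * (b - a) = \int[lebesgue_measure]_(x in `[a, b]) (fun=> M) x.
  by rewrite Rintegral_cst//= lebesgue_measure_itv/= lte_fin;
    case: ltgtP ab => //= -> _; rewrite subrr.
apply: le_Rintegral => //.
  apply: integrable_continuous => x.
  by apply: continuous_comp; [exact: ch|exact: norm_continuous].
by apply: integrable_continuous; exact: cst_continuous.
Qed.

(** The factor 2 comes from bounding the two real integrals separately. This crude bound suffices,
    as it only serves to show that some remainder tends to zero. *)
Lemma normc_complex_integral_le f a b (M : R) : a <= b -> continuousC f ->
  (forall x, normc (f x) <= M) ->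
  normc (complex_integral a b f) <= 2 * (M * (b - a)).
Proof.
move=> ab [f1 f2] fM; apply: le_trans (normc_le_ReIm _) _ => /=.
rewrite mulr_natl mulr2n lerD//; apply: Rintegral_le_bound => // x;
  by [exact: le_trans (ReIm_le_normc _).1 (fM x)|
      exact: le_trans (ReIm_le_normc _).2 (fM x)].
Qed.

End ContinuousComplexIntegrands.

(** * Circle integrals *)

Section CircleIntegral.
Variable R : realType.
Implicit Types (r x y : R) (a z : R[i]) (n : nat).

(** This is $e^{ix}$; the clockwise path [circle_path r x] is $r e^{-ix}$. *)
Definition cis x : R[i] := cos x +i* sin x.

Lemma cis0 : cis 0 = 1.
Proof. by rewrite /cis cos0 sin0. Qed.

Lemma cisD x y : cis (x + y) = cis x * cis y.
Proof. by rewrite /cis cosD sinD; simpc; rewrite [sin x * _ + _]addrC. Qed.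

Lemma cisN x : cis (- x) = (cis x)^-1.
Proof.
have e : cis x * cis (- x) = 1 by rewrite -cisD subrr cis0.
have c0 : cis x != 0 by apply/eqP => c; move: e => /eqP; rewrite c mul0r eq_sym oner_eq0.
by apply: (mulfI c0); rewrite e divff.
Qed.

Lemma cisMn n x : cis (n%:R * x) = cis x ^+ n.
Proof.
elim: n => [|n IH]; first by rewrite mul0r cis0.
by rewrite mulrSr mulrDl mul1r exprSr cisD IH.
Qed.

Lemma cis_2pi : cis (2 * pi) = 1.
Proof. by rewrite /cis mulr_natl cos2pi sin2pi. Qed.

Lemma normc_cis x : normc (cis x) = 1.
Proof. by rewrite /= cos2Dsin2 sqrtr1. Qed.

Lemma circle_pathE r x : circle_path r x = r%:C * (cis x)^-1.
Proof. by rewrite -cisN /cis cosN sinN /circle_path; simpc. Qed.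

Lemma circle_path'E r x : circle_path' r x = - 'i * circle_path r x.
Proof. by rewrite /circle_path /circle_path'; simpc. Qed.

Lemma normc_circle_path r x : 0 < r -> normc (circle_path r x) = r.
Proof.
move=> r0; rewrite circle_pathE normcM normcV normc_cis invr1 mulr1 /=.
by rewrite expr0n addr0 sqrtr_sqr gtr0_norm.
Qed.

Lemma continuous_scale (k : R) : continuous (fun x => k * x).
Proof. by apply: continuous_mul => x; [exact: cst_continuous|exact: cvg_id]. Qed.

Lemma continuousC_cis (k : R) : continuousC (fun x => cis (k * x)).
Proof.
split => x; apply: continuous_comp; by [exact: continuous_scale|
  exact: continuous_cos|exact: continuous_sin].
Qed.

Lemma continuousC_circle_path r : continuousC (circle_path r).
Proof.
rewrite (_ : circle_path r = fun x => r%:C * cis (-1 * x)).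
  by apply: continuousCM; [exact: continuousC_cst|exact: continuousC_cis].
by apply/funext => x; rewrite circle_pathE mulN1r cisN.
Qed.

Lemma Rintegral_derivative (F f : R -> R) (u v : R) : u < v ->
  continuous f -> (forall x, is_derive x 1 F (f x)) ->
  \int[lebesgue_measure]_(x in `[u, v]) f x = F v - F u.
Proof.
move=> uv cf dF.
have dF' x : derivable F x 1 by case: (dF x).
have cF : continuous F.
  by move=> x; apply/differentiable_continuous/derivable1_diffP.
rewrite /Rintegral (@continuous_FTC2 _ f F u v uv)//.
- exact: continuous_subspaceT.
- split => //; [exact: cvg_at_right_filter (cF u)|
                exact: cvg_at_left_filter (cF v)].
- by move=> x _; rewrite derive1E; case: (dF x).
Qed.

(** The primitives $\sin(kx)/k$ and $-\cos(kx)/k$ of the two parts take the same value at both ends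
    of the period. *)
Lemma complex_integral_cis (k : R) : k != 0 -> cis (k * (2 * pi)) = 1 ->
  complex_integral 0 (2 * pi) (fun x => cis (k * x)) = 0.
Proof.
move=> k0 [ck sk]; rewrite /complex_integral /=.
have pi2 : 0 < 2 * pi :> R by rewrite mulr_gt0// pi_gt0.
have [cc cs] := continuousC_cis k.
have dk x : is_derive x 1 ( *%R k) k.
  by apply: is_derive_eq; rewrite ?derive_id ?mulr1 ?scaler1.
have ds x : is_derive x 1 (fun x => k^-1 * sin (k * x)) (cos (k * x)).
  by apply: is_derive_eq; rewrite -[LHS]/(k^-1 * _) mulrCA mulVf// mulr1.
have dc x : is_derive x 1 (fun x => - k^-1 * cos (k * x)) (sin (k * x)).
  apply: is_derive_eq; rewrite -[LHS]/(- k^-1 * _) mulNr mulNr mulrN opprK.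
  by rewrite mulrCA mulVf// mulr1.
apply/eqP; rewrite eq_complex /=; apply/andP; split; apply/eqP.
  by rewrite (Rintegral_derivative pi2 cc ds) sk !mulr0 sin0 mulr0 subrr.
by rewrite (Rintegral_derivative pi2 cs dc) ck mulr0 cos0 subrr.
Qed.

(** The sign covers both frequencies: positive powers of the clockwise path have frequency $-n$,
    negative powers have frequency $n$. *)
Lemma complex_integral_cisn (b : bool) n : (0 < n)%N ->
  complex_integral 0 (2 * pi) (fun x => cis ((-1) ^+ b * n%:R * x)) = 0.
Proof.
move=> n0; have nR : n%:R != 0 :> R by rewrite pnatr_eq0 -lt0n.
apply: complex_integral_cis; first by rewrite mulf_neq0// signr_eq0.
rewrite -mulrA; case: b => /=; last by rewrite mul1r cisMn cis_2pi expr1n.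
by rewrite mulN1r cisN cisMn cis_2pi expr1n invr1.
Qed.

Lemma complex_integral1 : complex_integral 0 (2 * pi) (fun=> 1) = (2 * pi)%:C :> R[i].
Proof.
have pi2 : 0 <= 2 * pi :> R by rewrite mulr_ge0// pi_ge0.
rewrite /complex_integral !Rintegral_cst//= mul0r lebesgue_measure_itv/= lte_fin.
by case: ltgtP pi2 => //= [_|<-] _; rewrite ?oppr0 ?addr0 ?subr0 ?mul1r ?mulr0.
Qed.

(** On the clockwise circle $dz = -iz\,dx$, so a circle integral is $-i$ times the plain integral of
    $z f(z)$ in the angle. *)
Lemma circle_integralE r (f : R[i] -> R[i]) :
  continuousC (fun x => f (circle_path r x)) ->
  circle_integral r f =
  - 'i * complex_integral 0 (2 * pi) (fun x => f (circle_path r x) * circle_path r x).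
Proof.
move=> cf; rewrite /circle_integral -complex_integralZ.
  by congr complex_integral; apply/funext => x; rewrite circle_path'E mulrCA.
by apply: continuousCM => //; exact: continuousC_circle_path.
Qed.

Lemma complex_integral_path_exp r n : (0 < n)%N ->
  complex_integral 0 (2 * pi) (fun x => circle_path r x ^+ n) = 0.
Proof.
move=> n0; rewrite -[RHS](mulr0 (r%:C ^+ n)) -(complex_integral_cisn true n0).
rewrite -complex_integralZ; last exact: continuousC_cis.
congr complex_integral; apply/funext => x.
by rewrite circle_pathE exprMn exprVn -cisMn -cisN expr1 !mulN1r mulNr.
Qed.

Lemma complex_integral_path_expV r n : (0 < n)%N ->
  complex_integral 0 (2 * pi) (fun x => (circle_path r x)^-1 ^+ n) = 0.
Proof.
move=> n0; rewrite -[RHS](mulr0 (r%:C ^- n)) -(complex_integral_cisn false n0).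
rewrite -complex_integralZ; last exact: continuousC_cis.
congr complex_integral; apply/funext => x.
by rewrite circle_pathE invfM invrK exprMn exprVn -cisMn expr0 mul1r.
Qed.

(** The factor $z$ from $dz$ shifts all exponents to at least 1, and such powers have zero mean over
    the circle. *)
Lemma circle_integral_poly r (p : {poly R[i]}) :
  circle_integral r (horner p) = 0.
Proof.
have cp n : continuousC (fun x => circle_path r x ^+ n).
  by apply: continuousCX; exact: continuousC_circle_path.
have cF (i : 'I_(size p)) : continuousC (fun x => p`_i * circle_path r x ^+ i).
  by apply: continuousCM; [exact: continuousC_cst|exact: cp].
rewrite circle_integralE; last first.
  under eq_fun do rewrite horner_coef; exact: continuousC_sum.
rewrite (_ : (fun x => _) = (fun x =>
    \sum_(i < size p) p`_i * circle_path r x ^+ i.+1)); last first.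
  apply/funext => x; rewrite horner_coef mulr_suml.
  by apply: eq_bigr => i _; rewrite exprSr mulrA.
rewrite complex_integral_sum => [|i]; last first.
  by apply: continuousCM; [exact: continuousC_cst|exact: cp].
rewrite big1 ?mulr0// => i _; rewrite complex_integralZ//.
by rewrite complex_integral_path_exp ?mulr0.
Qed.

Lemma normc_ge0 z : 0 <= normc z.
Proof. by case: z => u v; exact: sqrtr_ge0. Qed.

Lemma normcX z n : normc (z ^+ n) = normc z ^+ n.
Proof.
by elim: n => [|n IH]; rewrite ?expr0 ?normc1// !exprS normcM IH.
Qed.

Lemma circle_path_neq r a x : normc a < r -> circle_path r x - a != 0.
Proof.
move=> ar; have r0 := le_lt_trans (normc_ge0 a) ar.
rewrite subr_eq0; apply: contraTneq ar => <-.
by rewrite normc_circle_path// ltxx.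
Qed.

Lemma geometric_bound_eq0 (s C q : R) : 0 <= s -> 0 <= q < 1 ->
  (forall n, s <= C * q ^+ n) -> s = 0.
Proof.
move=> s0 /andP[q0 q1] sq; apply/le_anti; rewrite s0 andbT.
have cq : (C * q ^+ n @[n --> \oo] --> C * 0)%classic.
  by apply: cvgMr; apply: cvg_expr; rewrite ger0_norm.
rewrite mulr0 in cq.
by apply: (cvgr_to_ge cq); exact: nearW.
Qed.

(* Multiplying by [z] turns [1/(z-a)] into the geometric series in [a/z]; only
   its constant term has a nonzero mean over the circle. *)
Lemma circle_integral_pole r a : normc a < r ->
  circle_integral r (fun z => (z - a)^-1) = - 'i * (2 * pi)%:C.
Proof.
move=> ar; have r0 := le_lt_trans (normc_ge0 a) ar.
have z0 x : circle_path r x != 0.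
  by rewrite -[circle_path r x]subr0; apply: circle_path_neq; rewrite normc0.
have za0 x := circle_path_neq x ar.
have cz := continuousC_circle_path r.
have cza : continuousC (fun x => (circle_path r x - a)^-1).
  by apply: continuousCV => //; apply: continuousCD => //; exact: continuousC_cst.
pose u n x := (a / circle_path r x) ^+ n.
have cu n : continuousC (u n).
  apply: continuousCX; apply: continuousCM; first exact: continuousC_cst.
  exact: continuousCV.
(* [v n] is the tail from order [n] on of the geometric series of $z/(z-a)$ in $a/z$; peeling off
   its first term [u n] gives the recursion [SS]. *)
pose v n x := u n x * ((circle_path r x - a)^-1 * circle_path r x).
have cv n : continuousC (v n).
  by apply: continuousCM => //; exact: continuousCM.
pose S n := complex_integral 0 (2 * pi) (v n).
have SS n : S n = complex_integral 0 (2 * pi) (u n) + S n.+1.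
  rewrite /S -complex_integralD//; congr complex_integral; apply/funext => x.
  rewrite /v /u exprSr; field; by rewrite z0 za0.
have u0 n : complex_integral 0 (2 * pi) (u n.+1) = 0.
  rewrite (_ : u n.+1 = fun x => a ^+ n.+1 * (circle_path r x)^-1 ^+ n.+1).
    rewrite complex_integralZ ?complex_integral_path_expV ?mulr0//.
    by apply: continuousCX; exact: continuousCV.
  by apply/funext => x; rewrite /u exprMn.
have S1 n : S 1%N = S n.+1.
  by elim: n => // n ->; rewrite SS u0 add0r.
(* All tails from order 1 on have the same integral, because the peeled terms integrate to zero; on
   the circle the tails decay like powers of $|a|/r < 1$. *)
have S10 : S 1%N = 0.
  apply: eq0_normc; pose q := normc a / r.
  have q01 : 0 <= q < 1.
    by rewrite /q divr_ge0 ?normc_ge0 ?(ltW r0)//= ltr_pdivrMr// mul1r.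
  apply: (@geometric_bound_eq0 _ (2 * (q * (r / (r - normc a)) * (2 * pi - 0))) q) => //.
    exact: normc_ge0.
  move=> n; rewrite (S1 n).
  (* The second factor bounds $|z/(z-a)|$ on the circle, since $|z-a| \ge r-|a|$. *)
  pose M := q ^+ n.+1 * (r / (r - normc a)).
  apply: le_trans (normc_complex_integral_le (M := M) _ (cv _) _) _.
  - by rewrite mulr_ge0// pi_ge0.
  - move=> x; rewrite /M /v /u !normcM.
    rewrite normcX normcM !normcV normc_circle_path//.
    apply: ler_wpM2l; first by rewrite exprn_ge0//; case/andP: q01.
    rewrite mulrC ler_wpM2l ?(ltW r0)// lef_pV2 ?posrE ?subr_gt0//.
      rewrite lerBlDr -{1}(normc_circle_path x r0).
      by rewrite -{1}[circle_path r x](subrK a) le_normcD.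
    rewrite lt_def normc_ge0 andbT; apply/negP => /eqP /eq0_normc /eqP.
    by rewrite (negbTE (za0 x)).
  - rewrite /M exprS; move: (r / _) (q ^+ n) => k e.
    by rewrite le_eqVlt; apply/predU1P; left; ring.
rewrite circle_integralE//; congr (_ * _).
rewrite -complex_integral1 -[RHS]addr0 -S10.
rewrite [X in _ = X + _](_ : _ = complex_integral 0 (2 * pi) (u 0%N)) -?SS.
  by congr complex_integral; apply/funext => x; rewrite /v /u expr0 mul1r.
by congr complex_integral; apply/funext => x; rewrite /u expr0.
Qed.

Lemma circle_integralD r (f g : R[i] -> R[i]) :
  continuousC (fun x => f (circle_path r x)) ->
  continuousC (fun x => g (circle_path r x)) ->
  circle_integral r (fun z => f z + g z) = circle_integral r f + circle_integral r g.
Proof.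
move=> cf cg; have cz := continuousC_circle_path r.
rewrite !circle_integralE//; last exact: continuousCD.
rewrite -mulrDr -complex_integralD; [|exact: continuousCM..].
by under eq_fun do rewrite mulrDl.
Qed.

Lemma circle_integral_eq r (f g : R[i] -> R[i]) :
  (forall x, f (circle_path r x) = g (circle_path r x)) ->
  circle_integral r f = circle_integral r g.
Proof.
by move=> fg; congr complex_integral; apply/funext => x; rewrite fg.
Qed.

(** The polynomial part integrates to zero, and each simple pole inside the circle contributes the
    same constant $-2\pi i$, wherever it lies. *)
Lemma circle_integral_partial_fraction r (I : finType) (w a : I -> R[i])
    (q : {poly R[i]}) : (forall i, normc (a i) < r) ->
  circle_integral r (fun z => q.[z] + \sum_i w i * (z - a i)^-1) =
  - 'i * (2 * pi)%:C * \sum_i w i.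
Proof.
move=> ar; have cz := continuousC_circle_path r.
have cw i : continuousC (fun x => w i * (circle_path r x - a i)^-1).
  apply: continuousCM; first exact: continuousC_cst.
  apply: continuousCV => [x|]; first exact: circle_path_neq.
  by apply: continuousCD => //; exact: continuousC_cst.
have cpole i : continuousC (fun x => (circle_path r x - a i)^-1).
  apply: continuousCV => [x|]; first exact: circle_path_neq.
  by apply: continuousCD => //; exact: continuousC_cst.
rewrite circle_integralD.
- rewrite circle_integral_poly add0r circle_integralE; last exact: continuousC_sum.
  rewrite (_ : (fun x => _) = (fun x => \sum_i w i *
      ((circle_path r x - a i)^-1 * circle_path r x))); last first.
    by apply/funext => x; rewrite mulr_suml; apply: eq_bigr => i _; rewrite mulrA.
  rewrite complex_integral_sum; last first.
    by move=> i; apply: continuousCM; [exact: continuousC_cst|exact: continuousCM].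
  rewrite !mulr_sumr; apply: eq_bigr => i _.
  rewrite complex_integralZ; last exact: continuousCM.
  rewrite mulrCA -(circle_integralE (f := fun z => (z - a i)^-1))//.
  by rewrite circle_integral_pole// mulrC.
- under eq_fun do rewrite horner_coef; apply: continuousC_sum => i.
  by apply: continuousCM; [exact: continuousC_cst|exact: continuousCX].
- exact: continuousC_sum.
Qed.
End CircleIntegral.

(** * Iterated residues *)

(** Let [L] be the Lagrange interpolant of [p] at the points [a i]. Then [p - L] vanishes at all of
    them, so it is divisible by the denominator with quotient [q], while [L] over the denominator
    gives the simple fractions. *)
Lemma partial_fraction (F : fieldType) (I : finType) (a : I -> F)
    (p : {poly F}) : injective a ->
  exists q : {poly F}, forall z, (forall i, z != a i) ->
    p.[z] * (\prod_i (z - a i))^-1 =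
    q.[z] + \sum_i (p.[a i] / \prod_(l | l != i) (a i - a l)) * (z - a i)^-1.
Proof.
move=> inja; pose D i := \prod_(l | l != i) ('X - (a l)%:P).
pose L := \sum_i (p.[a i] / \prod_(l | l != i) (a i - a l)) *: D i.
have hD i z : (D i).[z] = \prod_(l | l != i) (z - a l).
  by rewrite horner_prod; apply: eq_bigr => l _; rewrite hornerXsubC.
have La i : L.[a i] = p.[a i].
  rewrite /L horner_sum (bigD1 i)//= hornerZ hD divfK; last first.
    by apply/prodf_neq0 => l li; rewrite subr_eq0 (inj_eq inja) eq_sym.
  rewrite [X in _ + X]big1 ?addr0// => l li.
  by rewrite hornerZ hD [X in _ * X](bigD1 i) 1?eq_sym//= subrr mul0r mulr0.
have /dvdpP[q pq] : \prod_(x <- [seq a i | i <- enum I]) ('X - x%:P) %| p - L.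
  apply: uniq_roots_dvdp.
    by apply/allP => x /mapP[i _ ->]; rewrite rootE hornerD hornerN La subrr.
  by rewrite uniq_rootsE map_inj_uniq// enum_uniq.
exists q => z za; have := congr1 (horner^~ z) pq.
rewrite hornerD hornerN hornerM horner_prod big_map big_enum /= => /eqP.
rewrite subr_eq => /eqP ->.
have -> : \prod_(i in I) ('X - (a i)%:P).[z] = \prod_i (z - a i).
  by apply: eq_bigr => i _; rewrite hornerXsubC.
have nz i : z - a i != 0 by rewrite subr_eq0.
rewrite mulrDl mulfK; last by apply/prodf_neq0.
congr (_ + _); rewrite /L horner_sum mulr_suml; apply: eq_bigr => i _.
rewrite hornerZ hD -[LHS]mulrA; congr (_ * _).
rewrite [X in _ * X^-1](bigD1 i)//= invfM mulrCA divff ?mulr1//.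
by apply/prodf_neq0.
Qed.

(** * Residues at simple poles, in one and in several variables *)

Section Residues.
Variable R : realType.

(** This is the residue theorem for simple poles: the circle avoids all poles, so the partial
    fraction identity may be integrated along it. The minus sign reflects the clockwise
    orientation. *)
Lemma circle_integral_residues (r : R) (I : finType) (a : I -> R[i])
    (p : {poly R[i]}) : injective a -> (forall i, normc (a i) < r) ->
  circle_integral r (fun z => p.[z] * (\prod_i (z - a i))^-1) =
  - 'i * (2 * pi)%:C * \sum_i p.[a i] / \prod_(l | l != i) (a i - a l).
Proof.
move=> inja ar; have [q pq] := partial_fraction p inja.
rewrite -(circle_integral_partial_fraction _ q ar).
apply: circle_integral_eq => x; apply: pq => i.
by rewrite -subr_eq0 circle_path_neq.
Qed.

(** Iterated integration freezes all variables but one, so polynomiality in each single variable is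
    the form of regularity used; it passes easily through sums, products and partial evaluation. *)
Definition separately_polynomial (F : nzRingType) n (P : ('I_n -> F) -> F) :=
  forall (j : 'I_n) (y : 'I_n -> F), exists p : {poly F},
    forall x, P [eta y with j |-> x] = p.[x].

Lemma separately_polynomial_cst (F : nzRingType) n (c : F) :
  @separately_polynomial F n (fun=> c).
Proof. by move=> j y; exists c%:P => x; rewrite hornerC. Qed.

Lemma separately_polynomial_proj (F : nzRingType) n (i : 'I_n) :
  separately_polynomial (fun y : 'I_n -> F => y i).
Proof.
move=> j y; exists (if i == j then 'X else (y i)%:P) => x /=.
by case: ifP => _; rewrite ?hornerX ?hornerC.
Qed.

Lemma separately_polynomialD (F : nzRingType) n (P Q : ('I_n -> F) -> F) :
  separately_polynomial P -> separately_polynomial Q ->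
  separately_polynomial (fun y => P y + Q y).
Proof.
move=> hP hQ j y; have [p hp] := hP j y; have [q hq] := hQ j y.
by exists (p + q) => x; rewrite hp hq hornerD.
Qed.

Lemma separately_polynomialN (F : nzRingType) n (P : ('I_n -> F) -> F) :
  separately_polynomial P -> separately_polynomial (fun y => - P y).
Proof.
move=> hP j y; have [p hp] := hP j y.
by exists (- p) => x; rewrite hp hornerN.
Qed.

Lemma separately_polynomialM (F : comNzRingType) n (P Q : ('I_n -> F) -> F) :
  separately_polynomial P -> separately_polynomial Q ->
  separately_polynomial (fun y => P y * Q y).
Proof.
move=> hP hQ j y; have [p hp] := hP j y; have [q hq] := hQ j y.
by exists (p * q) => x; rewrite hp hq hornerM.
Qed.

Lemma separately_polynomialX (F : comNzRingType) n (P : ('I_n -> F) -> F) k :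
  separately_polynomial P -> separately_polynomial (fun y => P y ^+ k).
Proof.
move=> hP j y; have [p hp] := hP j y.
by exists (p ^+ k) => x; rewrite hp horner_exp.
Qed.

Lemma separately_polynomial_sum (F : nzRingType) n (I : Type) (s : seq I)
    (B : pred I) (P : I -> ('I_n -> F) -> F) :
  (forall i, separately_polynomial (P i)) ->
  separately_polynomial (fun y => \sum_(i <- s | B i) P i y).
Proof.
move=> hP j y; elim: s => [|i s [q hq]].
  by exists 0 => x; rewrite big_nil horner0.
have [p hp] := hP i j y; exists (if B i then p + q else q) => x.
by rewrite big_cons hq; case: ifP => //; rewrite hp hornerD.
Qed.

Lemma separately_polynomial_prod (F : comNzRingType) n (I : Type) (s : seq I)
    (B : pred I) (P : I -> ('I_n -> F) -> F) :
  (forall i, separately_polynomial (P i)) ->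
  separately_polynomial (fun y => \prod_(i <- s | B i) P i y).
Proof.
move=> hP j y; elim: s => [|i s [q hq]].
  by exists 1 => x; rewrite big_nil hornerC.
have [p hp] := hP i j y; exists (if B i then p * q else q) => x.
by rewrite big_cons hq; case: ifP => //; rewrite hp hornerM.
Qed.

Lemma separately_polynomial_meval (F : comNzRingType) n (V : mpoly n F) :
  separately_polynomial (fun y => meval y V).
Proof.
rewrite (_ : (fun y => _) = (fun y => \sum_(m <- msupp V)
    mcoeff m V * \prod_(i < n) y i ^+ fun_of_multinom m i)).
  apply: separately_polynomial_sum => m; apply: separately_polynomialM.
    exact: separately_polynomial_cst.
  apply: separately_polynomial_prod => i; apply: separately_polynomialX.
  exact: separately_polynomial_proj.
by apply/funext => y; rewrite mevalE.
Qed.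

Lemma sum_tuple_cons (F : nmodType) (I : finType) n (E : n.+1.-tuple I -> F) :
  \sum_(s : n.+1.-tuple I) E s =
  \sum_(i : I) \sum_(s : n.-tuple I) E [tuple of i :: s].
Proof.
rewrite pair_big /= (reindex (fun q : I * n.-tuple I => [tuple of q.1 :: q.2]))//=.
exists (fun s => (thead s, [tuple of behead s])) => [[i s] _|s _] /=.
  by rewrite theadE; congr pair; apply: val_inj.
by apply: val_inj; rewrite /= [in RHS](tuple_eta s).
Qed.

(** This is the counterpart for functions of prepending an entry to a tuple: numerators take
    functions on ordinals, whereas [iterated_integral] recurses on tuples. *)
Definition fcons (F : Type) n (x : F) (y : 'I_n -> F) (k : 'I_n.+1) : F :=
  oapp y x (unlift ord0 k).

Lemma fcons0 (F : Type) n (x : F) (y : 'I_n -> F) : fcons x y ord0 = x.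
Proof. by rewrite /fcons unlift_none. Qed.

Lemma fconsS (F : Type) n (x : F) (y : 'I_n -> F) j :
  fcons x y (lift ord0 j) = y j.
Proof. by rewrite /fcons liftK. Qed.

Lemma tnth_cons (F : Type) n (x : F) (s : n.-tuple F) :
  tnth [tuple of x :: s] = fcons x (tnth s).
Proof.
apply/funext => k; rewrite /fcons; case: unliftP => [j ->|->] /=.
  by rewrite tnthS.
by rewrite tnth0.
Qed.

(** Induction on the number of variables. The denominator is a product of functions of one variable,
    so the poles on each circle do not depend on the other variables. Evaluating the inner integrals
    leaves a polynomial in the outermost variable times its own factor [g]. *)
Lemma iterated_integral_separable n (rs : n.-tuple R) (g : R[i] -> R[i])
    (I : finType) (w a : I -> R[i]) (K : R[i]) :
  (forall r, r \in rs -> forall p : {poly R[i]},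
     circle_integral r (fun z => p.[z] * g z) = K * \sum_i p.[a i] * w i) ->
  forall P, separately_polynomial P ->
  iterated_integral rs (fun z => P (tnth z) * \prod_(j < n) g (tnth z j)) =
  K ^+ n * \sum_(s : n.-tuple I)
    P (fun j => a (tnth s j)) * \prod_(j < n) w (tnth s j).
Proof.
elim: n rs => [|n IH] rs hg P hP /=.
  rewrite expr0 mul1r (big_pred1 [tuple]) => [|s]; last by apply/esym/eqP; exact: tuple0.
  by rewrite !big_ord0; congr (P _ * _); apply/funext => -[].
have hg' r : r \in [tuple of behead rs] -> forall p : {poly R[i]},
    circle_integral r (fun z => p.[z] * g z) = K * \sum_i p.[a i] * w i.
  by move=> /mem_behead; exact: hg.
have hP' x : separately_polynomial (fun y => P (fcons x y)).
  move=> j y; have [p hp] := hP (lift ord0 j) (fcons x y).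
  exists p => z; rewrite -hp; congr P; apply/funext => k.
  rewrite /fcons /=; case: (unliftP ord0 k) => [k' ->|->] /=.
    by rewrite (inj_eq lift_inj).
  done.
pose A (s : n.-tuple I) := fun j => a (tnth s j).
have hp (s : n.-tuple I) : exists p : {poly R[i]},
    forall x, P (fcons x (A s)) = p.[x].
  have [p hp] := hP ord0 (fcons 0 (A s)).
  exists p => x; rewrite -hp; congr P; apply/funext => k.
  by rewrite /fcons /=; case: (unliftP ord0 k) => [k' ->|->] /=.
have /fin_all_exists[p {}hp] := hp.
(* [q] is the value of the inner integrals as a polynomial in the outermost variable, once the
   factor [g z] is removed. *)
pose q := K ^+ n *: \sum_(s : n.-tuple I) (\prod_(j < n) w (tnth s j)) *: p s.
rewrite (_ : (fun z => _) = fun z => q.[z] * g z); last first.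
  apply/funext => z.
  rewrite (_ : (fun zs => _) = (fun zs => (g z * P (fcons z (tnth zs))) *
      \prod_(j < n) g (tnth zs j))); last first.
    apply/funext => zs; rewrite tnth_cons big_ord_recl fcons0 mulrCA mulrA.
    by congr (_ * _); apply: eq_bigr => j _; rewrite fconsS.
  (* For the inner variables [g z] is a constant, so it is absorbed into their numerator. *)
  rewrite (IH _ hg' (fun y => g z * P (fcons z y))); last first.
    by apply: separately_polynomialM => //; exact: separately_polynomial_cst.
  rewrite /q hornerZ horner_sum -mulrA; congr (_ * _); rewrite mulr_suml.
  by apply: eq_bigr => s _; rewrite hornerZ hp mulrC mulrA [_ * g z]mulrC; ring.
rewrite hg; last exact: mem_tnth.
rewrite exprS -mulrA; congr (_ * _).
rewrite sum_tuple_cons mulr_sumr; apply: eq_bigr => i _.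
rewrite /q hornerZ horner_sum -mulrA; congr (_ * _); rewrite mulr_suml.
apply: eq_bigr => s _; rewrite hornerZ -hp big_ord_recl.
rewrite tnth_cons fcons0.
have -> : (fun j => a (fcons i (tnth s) j)) = fcons (a i) (A s).
  apply/funext => k; case: (unliftP ord0 k) => [k' ->|->].
    by rewrite !fconsS.
  by rewrite !fcons0.
under [in RHS]eq_bigr do rewrite fconsS.
by ring.
Qed.

End Residues.

(** One threshold [M], common to all radii, witnesses every nested eventuality. *)
Lemma for_large_radii_gt (R : realType) (M : R) n (P : n.-tuple R -> Prop) :
  (forall rs, (forall r, r \in rs -> M < r) -> P rs) -> for_large_radii P.
Proof.
elim: n P => [|n IH] P hP /=; first exact: hP.
exists M; split; first exact: num_real.
move=> r Mr; apply: IH => rs hrs; apply: hP => x.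
by rewrite inE => /predU1P[->//|]; exact: hrs.
Qed.

(** * The residue at infinity as a sum over the poles $\pm t_i$ *)

Section SignedRoots.
Variables (R : realType) (n : nat) (t : 'I_n -> R[i]).
Hypothesis ht : generic t.

Definition signed_root (q : 'I_n * bool) : R[i] := if q.2 then t q.1 else - t q.1.

(** This is minus the residue of $\prod_i ((t_i-z)(t_i+z))^{-1}$ at [signed_root q], that is, the
    contribution of this pole to the residue at infinity. *)
Definition root_weight (q : 'I_n * bool) : R[i] :=
  (2 * signed_root q * \prod_(i | i != q.1) (t i ^+ 2 - t q.1 ^+ 2))^-1.

Lemma sqr_signed_root q : signed_root q ^+ 2 = t q.1 ^+ 2.
Proof. by rewrite /signed_root; case: ifP => _; rewrite ?sqrrN. Qed.

(** Genericity makes the $2n$ poles distinct, hence simple: $t_k \ne -t_k$ because $t_k \ne 0$, and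
    $t_k \ne \pm t_l$ for $k \ne l$. *)
Lemma signed_root_inj : injective signed_root.
Proof.
have [t0 tt] := ht; move=> [k b] [l c] /=; rewrite /signed_root /=.
have [<-{l}|kl] := eqVneq k l.
  have nt : t k != - t k by rewrite -subr_eq0 opprK -mulr2n mulrn_eq0 negb_or/= t0.
  by case: b c => -[]// /eqP; rewrite ?(negbTE nt)// eq_sym (negbTE nt).
have [n1 n2] := tt _ _ kl.
case: b c => -[] /eqP; rewrite ?eqr_opp ?eqr_oppLR ?(negbTE n1) ?(negbTE n2)//.
Qed.

Lemma prod_signed_root (z : R[i]) :
  \prod_(i < n) ((t i - z) * (t i + z)) =
  (-1) ^+ n * \prod_q (z - signed_root q).
Proof.
rewrite -(pair_bigA _ (fun i b => z - signed_root (i, b)))/=.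
under [in RHS]eq_bigr do rewrite big_bool /signed_root/= opprK.
rewrite -[X in _ ^+ X](card_ord n) -prodrN; apply: eq_bigr => i _; ring.
Qed.

(** With $u = \pm t_k$ the chosen root, the index $k$ contributes only the opposite root, hence
    $2u$. Each of the other $n-1$ indices contributes $(u-t_i)(u+t_i) = -(t_i^2-t_k^2)$. *)
Lemma prod_signed_rootD q :
  \prod_(l | l != q) (signed_root q - signed_root l) =
  2 * signed_root q * ((-1) ^+ n.-1 * \prod_(i | i != q.1) (t i ^+ 2 - t q.1 ^+ 2)).
Proof.
case: q => k b /=; set u := signed_root (k, b).
have -> : \prod_(l | l != (k, b)) (u - signed_root l) =
    \prod_i \prod_(c | (i, c) != (k, b)) (u - signed_root (i, c)).
  by rewrite pair_big_dep /=; apply: eq_big => [[i c]|[i c] _].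
rewrite (bigD1 k)//=; congr (_ * _).
  rewrite (big_pred1 (~~ b)); last first.
    by move=> c; rewrite xpair_eqE eqxx/=; case: b u c => u [].
  rewrite /u /signed_root /=; case: b {u} => /=; ring.
have -> : n.-1 = #|predC1 k| by rewrite cardC1 card_ord.
rewrite -prodrN; apply: eq_bigr => i ik.
rewrite (eq_bigl predT); last by move=> c; rewrite xpair_eqE (negbTE ik).
rewrite big_bool /signed_root /= -(sqr_signed_root (k, b)) -/u; ring.
Qed.

Lemma circle_integral_signed_roots (r : R) (p : {poly R[i]}) :
  (forall q, normc (signed_root q) < r) ->
  circle_integral r (fun z => p.[z] * (\prod_(i < n) ((t i - z) * (t i + z)))^-1)
  = (0 +i* (2 * pi)) * \sum_q p.[signed_root q] * root_weight q.
Proof.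
move=> hr.
have := circle_integral_residues ((-1) ^+ n *: p) signed_root_inj hr.
rewrite (_ : (fun z => _) = (fun z =>
    p.[z] * (\prod_(i < n) ((t i - z) * (t i + z)))^-1)); last first.
  apply/funext => z; rewrite prod_signed_root hornerZ invfM.
  by rewrite -exprVn invrN invr1 mulrA [p.[z] * _]mulrC.
move=> ->; set c := - 'i * _.
have -> : 0 +i* (2 * pi) = - c by rewrite /c; simpc.
rewrite mulNr -mulrN -sumrN; congr (_ * _); apply: eq_bigr => q _.
rewrite hornerZ prod_signed_rootD /root_weight !invfM -exprVn invrN invr1.
(* The signs of the denominator and of its derivative differ by one factor $-1$, which turns $-2\pi
   i$ into $2\pi i$. The existence of the index [q.1] ensures that [n] is positive. *)
have -> : (-1) ^+ n = - (-1) ^+ n.-1 :> R[i].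
  have n0 : (0 < n)%N by rewrite (leq_ltn_trans _ (ltn_ord q.1)).
  by rewrite -{1}(prednK n0) exprS mulN1r.
have := signrMK n.-1 (1 : R[i]); rewrite mulr1.
move: ((-1) ^+ n.-1) (2^-1) (\prod_(i | _) _)^-1 => e h d ee.
move: p.[_] (_^-1) => x y.
by rewrite -[RHS]mulr1 -ee; ring.
Qed.

Theorem is_residue_signed_roots (P : ('I_n -> R[i]) -> R[i]) :
  separately_polynomial P ->
  is_residue_at_infinity
    (fun z => P z / \prod_(i < n) \prod_(j < n) ((t i - z j) * (t i + z j)))
    (\sum_(s : n.-tuple ('I_n * bool))
       P (fun j => signed_root (tnth s j)) * \prod_(j < n) root_weight (tnth s j)).
Proof.
(* The sum of the moduli of all poles dominates each of them, so every circle encloses all poles. *)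
move=> hP; apply: (@for_large_radii_gt _ (\sum_q normc (signed_root q))) => rs hrs.
pose g z := (\prod_(i < n) ((t i - z) * (t i + z)))^-1.
rewrite (_ : (fun z => _) =
  (fun z => P (tnth z) * \prod_(j < n) g (tnth z j))); last first.
  by apply/funext => z; rewrite exchange_big /= -prodfV.
rewrite (iterated_integral_separable (w := root_weight) (a := signed_root)
  (K := 0 +i* (2 * pi))).
- rewrite mulKf// expf_neq0// eq_complex /= eqxx /=.
  by rewrite mulf_neq0// gt_eqF// pi_gt0.
- move=> r /hrs hr p; apply: circle_integral_signed_roots => q.
  apply: le_lt_trans hr; rewrite (bigD1 q)//= lerDl sumr_ge0// => l _.
  exact: normc_ge0.
- exact: hP.
Qed.
End SignedRoots.

(** * Torus-fixed points *)

Section FixedPoints.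
Variables (R : realType) (n : nat).
Local Notation N := (n + n + 1)%N.
Local Notation e j := (delta_mx 0 j : 'rV[R[i]]_N).
Implicit Types (W : {vspace 'rV[R[i]]_N}) (B : {set 'I_n}).

Variant coordinate_spec : 'I_N -> Type :=
| CoordinateQ i : coordinate_spec (q_idx i)
| CoordinateP i : coordinate_spec (p_idx i)
| CoordinateR : coordinate_spec (r_idx n).

Lemma coordinateP j : coordinate_spec j.
Proof.
case: (split_ordP j) => k ->{j}; last by rewrite ord1; exact: CoordinateR.
by case: (split_ordP k) => i ->{k}; [exact: CoordinateQ|exact: CoordinateP].
Qed.

Lemma q_idx_eq (i k : 'I_n) : (q_idx i == q_idx k) = (i == k).
Proof. by rewrite /q_idx !eq_lshift. Qed.

Lemma p_idx_eq (i k : 'I_n) : (p_idx i == p_idx k) = (i == k).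
Proof. by rewrite /p_idx eq_lshift eq_rshift. Qed.

Lemma qp_idx_eq (i k : 'I_n) : (q_idx i == p_idx k) = false.
Proof. by rewrite /q_idx /p_idx eq_lshift eq_lrshift. Qed.

Lemma qr_idx_eq (i : 'I_n) : (q_idx i == r_idx n) = false.
Proof. by rewrite /q_idx /r_idx eq_lrshift. Qed.

Lemma pr_idx_eq (i : 'I_n) : (p_idx i == r_idx n) = false.
Proof. by rewrite /p_idx /r_idx eq_lrshift. Qed.

Definition idx_eq := (q_idx_eq, p_idx_eq, qp_idx_eq, qr_idx_eq, pr_idx_eq,
  fun i k => etrans (eq_sym (p_idx i) (q_idx k)) (qp_idx_eq k i),
  fun i => etrans (eq_sym (r_idx n) (q_idx i)) (qr_idx_eq i),
  fun i => etrans (eq_sym (r_idx n) (p_idx i)) (pr_idx_eq i)).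

Definition fixed_coord B (i : 'I_n) : 'I_N := if i \in B then q_idx i else p_idx i.

Lemma fixed_coord_inj B : injective (fixed_coord B).
Proof.
move=> i k /eqP; rewrite /fixed_coord; do 2 case: ifP => _;
  by rewrite ?q_idx_eq ?p_idx_eq ?qp_idx_eq // ?[p_idx _ == _]eq_sym ?qp_idx_eq // => /eqP.
Qed.

Lemma q_idx_fixed_coord B i : (q_idx i \in codom (fixed_coord B)) = (i \in B).
Proof.
apply/codomP/idP => [[k]|iB]; last by exists i; rewrite /fixed_coord iB.
rewrite /fixed_coord; case: ifP => [kB /eqP|_ /eqP]; last by rewrite qp_idx_eq.
by rewrite q_idx_eq => /eqP ->.
Qed.

Lemma p_idx_fixed_coord B i : (p_idx i \in codom (fixed_coord B)) = (i \notin B).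
Proof.
apply/codomP/idP => [[k]|iB]; last by exists i; rewrite /fixed_coord (negbTE iB).
rewrite /fixed_coord; case: ifP => [_ /eqP|kB /eqP]; first by rewrite eq_sym qp_idx_eq.
by rewrite p_idx_eq => /eqP ->; rewrite kB.
Qed.

Lemma r_idx_fixed_coord B : (r_idx n \in codom (fixed_coord B)) = false.
Proof.
apply/codomP => -[k]; rewrite /fixed_coord.
by case: ifP => _ /eqP; rewrite eq_sym ?qr_idx_eq ?pr_idx_eq.
Qed.

(** This is the fixed point $p_I$ for $I$ equal to [B]. *)
Definition fixed_point B : {vspace 'rV[R[i]]_N} :=
  <<[tuple e (fixed_coord B i) | i < n]>>%VS.

Lemma mem_coordinates W (v : 'rV[R[i]]_N) :
  (forall j, v 0 j != 0 -> e j \in W) -> v \in W.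
Proof.
move=> vW; rewrite [v]row_sum_delta; apply: memv_suml => j _.
by have [->|/vW ?] := eqVneq (v 0 j) 0; rewrite ?scale0r ?mem0v// memvZ.
Qed.

(** For a coordinate subspace, membership is a condition on the support of the vector; the facts
    about fixed points thus reduce to facts about index sets. *)
Lemma fixed_pointP B (v : 'rV[R[i]]_N) :
  reflect (forall j, v 0 j != 0 -> j \in codom (fixed_coord B))
          (v \in fixed_point B).
Proof.
apply: (iffP idP) => [vW j|vB].
  apply: contraNT => jB; rewrite (coord_span vW) summxE big1// => i _.
  rewrite mxE -tnth_nth tnth_mktuple mxE eqxx /=.
  case: eqP jB => [->|]; last by rewrite mulr0.
  by rewrite codom_f.
apply: mem_coordinates => j /vB /codomP[i ->]; apply: memv_span.
by apply/tnthP; exists i; rewrite tnth_mktuple.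
Qed.

Lemma mem_fixed_point B j : (e j \in fixed_point B) = (j \in codom (fixed_coord B)).
Proof.
apply/fixed_pointP/idP => [|jB k]; first by apply; rewrite mxE !eqxx oner_eq0.
by rewrite mxE eqxx /=; have [->|] := eqVneq k j; rewrite ?eqxx.
Qed.

Lemma q_vec_fixed_point B i : (q_vec R i \in fixed_point B) = (i \in B).
Proof. by rewrite mem_fixed_point q_idx_fixed_coord. Qed.

Lemma fixed_point_inj : injective fixed_point.
Proof. by move=> B C BC; apply/setP => i; rewrite -!q_vec_fixed_point BC. Qed.

Lemma dim_fixed_point B : \dim (fixed_point B) = n.
Proof.
rewrite -[RHS](size_tuple [tuple e (fixed_coord B i) | i < n]); apply/eqP.
change (free [tuple e (fixed_coord B i) | i < n]).
apply/freeP => k k0 i.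
have {}k0 : \sum_(l < n) k l *: e (fixed_coord B l) = 0.
  by rewrite -[RHS]k0; apply: eq_bigr => l _; rewrite -tnth_nth tnth_mktuple.
have := congr1 (fun v : 'rV_N => v 0 (fixed_coord B i)) k0.
rewrite /= summxE (bigD1 i)//= big1 ?addr0 => [|l li].
  by rewrite !mxE !eqxx mulr1.
rewrite !mxE eqxx /= (inj_eq (@fixed_coord_inj B)).
by rewrite eq_sym (negbTE li) mulr0.
Qed.

Lemma fixed_point_coord0 B (v : 'rV[R[i]]_N) j :
  v \in fixed_point B -> j \notin codom (fixed_coord B) -> v 0 j = 0.
Proof. by move=> /fixed_pointP vB; apply: contraNeq; exact: vB. Qed.

(** Every vector has zero $r$-coordinate and, for each $i$, a zero $p_i$- or $q_i$-coordinate
    according to whether $i$ lies in [B]; so each term of the form vanishes. *)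
Lemma OG_fixed_point rho B : @OG R n rho (fixed_point B).
Proof.
split; first exact: dim_fixed_point.
move=> u v uB vB; rewrite /Defs.form.
rewrite (fixed_point_coord0 uB) ?r_idx_fixed_coord// mul0r mulr0 addr0.
rewrite big1// => i _; have [iB|iB] := boolP (i \in B).
  rewrite (fixed_point_coord0 (j := p_idx i) vB) ?p_idx_fixed_coord ?iB//.
  rewrite (fixed_point_coord0 (j := p_idx i) uB) ?p_idx_fixed_coord ?iB//.
  by rewrite mulr0 mul0r addr0.
rewrite (fixed_point_coord0 (j := q_idx i) vB) ?q_idx_fixed_coord//.
rewrite (fixed_point_coord0 (j := q_idx i) uB) ?q_idx_fixed_coord//.
by rewrite mulr0 mul0r addr0.
Qed.

(** * The torus action and the classification of its fixed points *)

Definition torus_weight (s : 'I_n -> R[i]) : 'rV[R[i]]_N :=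
  row_mx (row_mx (\row_i s i) (\row_i (s i)^-1)) (const_mx 1).

Lemma torus_weight_q s i : torus_weight s 0 (q_idx i) = s i.
Proof. by rewrite /torus_weight /q_idx !row_mxEl mxE. Qed.

Lemma torus_weight_p s i : torus_weight s 0 (p_idx i) = (s i)^-1.
Proof. by rewrite /torus_weight /p_idx row_mxEl row_mxEr mxE. Qed.

Lemma torus_weight_r s : torus_weight s 0 (r_idx n) = 1.
Proof. by rewrite /torus_weight /r_idx row_mxEr mxE. Qed.

Lemma torus_act s (v : 'rV[R[i]]_N) j :
  (linfun (mulmxr (torus_mx s)) v) 0 j = v 0 j * torus_weight s 0 j.
Proof. by rewrite lfunE /= mul_mx_diag mxE. Qed.

Lemma torus_weight_neq0 s j : (forall i, s i != 0) -> torus_weight s 0 j != 0.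
Proof.
move=> s0; case: (coordinateP j) => [i|i|].
- by rewrite torus_weight_q.
- by rewrite torus_weight_p invr_eq0.
- by rewrite torus_weight_r oner_eq0.
Qed.

Lemma torus_fixed_point B : torus_fixed (fixed_point B).
Proof.
move=> s s0; apply/eqP; rewrite eqEsubv; apply/andP; split; apply/subvP => v.
  move=> /memv_imgP[u /fixed_pointP uB ->]; apply/fixed_pointP => j.
  by rewrite torus_act mulf_eq0 negb_or => /andP[/uB].
move=> /fixed_pointP vB.
pose u : 'rV[R[i]]_N := \row_j (v 0 j / torus_weight s 0 j).
have -> : v = linfun (mulmxr (torus_mx s)) u.
  by apply/rowP => j; rewrite torus_act mxE divfK// torus_weight_neq0.
apply: memv_img; apply/fixed_pointP => j; rewrite mxE mulf_eq0 negb_or => /andP[+ _].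
exact: vB.
Qed.

(* An element of the torus with pairwise distinct weights on the coordinates. *)
Definition dyadic_weight (i : 'I_n) : R[i] := (2 ^+ i.+1)%:C.

(** The weights are powers of 2 with exponents $i+1$ on $q_i$, $-(i+1)$ on $p_i$ and 0 on $r$.
    Counting from 1 keeps the first two families apart from each other and from 0. *)
Lemma torus_weight_dyadic_inj : injective (torus_weight dyadic_weight 0).
Proof.
have exq (i : 'I_n) : dyadic_weight i = (2 ^ (i.+1 : int))%:C by [].
have exp (i : 'I_n) : (dyadic_weight i)^-1 = (2 ^ (- (i.+1 : int)))%:C.
  by rewrite -invr_expz fmorphV.
have exr : 1 = (2 ^ (0 : int))%:C :> R[i] by [].
have i2 : injective (exprz (2 : R)).
  by apply: ieexprIz; rewrite ?ltr0n// pnatr_eq1.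
move=> j k; case: (coordinateP j) => [i|i|]; case: (coordinateP k) => [l|l|];
  rewrite ?torus_weight_q ?torus_weight_p ?torus_weight_r ?exp ?exq ?exr;
  move=> /complexI/i2 //.
  by move=> [/val_inj ->].
by move=> /oppr_inj [/val_inj ->].
Qed.

(** A single torus element with distinct eigenvalues on the coordinate vectors already forces an
    invariant subspace to contain the eigencomponents of its vectors. *)
Lemma torus_fixed_coordinates W v j :
  torus_fixed W -> v \in W -> v 0 j != 0 -> e j \in W.
Proof.
move=> /(_ dyadic_weight) fW vW vj.
move: (torus_act dyadic_weight) torus_weight_dyadic_inj.
move: (torus_weight dyadic_weight 0) => d actd injd.
have {}fW : (linfun (mulmxr (torus_mx dyadic_weight)) @: W)%VS = W.
  by apply: fW => i; rewrite -[0]/(0%:C) (inj_eq (@complexI R)) expf_neq0// pnatr_eq0.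
have {}fW u : u \in W -> linfun (mulmxr (torus_mx dyadic_weight)) u \in W.
  by move=> uW; rewrite -fW memv_img.
(* Applying T - d_l for all l != j to v isolates its j-th coordinate. *)
have yW (L : seq 'I_N) : \row_k (\prod_(l <- L) (d k - d l) * v 0 k) \in W.
  elim: L => [|l L IH].
    rewrite (_ : (\row__ _) = v)//.
    by apply/rowP => k; rewrite mxE big_nil mul1r.
  set y := (X in X \in W) in IH.
  have -> : \row_k (\prod_(l <- l :: L) (d k - d l) * v 0 k) =
      linfun (mulmxr (torus_mx dyadic_weight)) y - d l *: y.
    by apply/rowP => k; rewrite !mxE actd !mxE big_cons; ring.
  by rewrite memvB ?memvZ// fW.
have := yW (enum (predC1 j)).
have -> : \row_k (\prod_(l <- enum (predC1 j)) (d k - d l) * v 0 k) =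
    (\prod_(l | l != j) (d j - d l) * v 0 j) *: e j.
  apply/rowP => k; rewrite !mxE eqxx /= big_enum /=.
  have [->|kj] := eqVneq k j; first by rewrite mulr1; congr (_ * _); apply: eq_bigl.
  by rewrite (bigD1 k)//= subrr !mul0r mulr0.
have c0 : \prod_(l | l != j) (d j - d l) * v 0 j != 0.
  rewrite mulf_neq0//; apply/prodf_neq0 => l lj.
  by rewrite subr_eq0 (inj_eq injd) eq_sym.
move=> /(memvZ (\prod_(l | l != j) (d j - d l) * v 0 j)^-1).
by rewrite scalerA mulVf// scale1r.
Qed.

Lemma torus_fixed_OG rho W : rho != 0 -> OG rho W -> torus_fixed W ->
  W = fixed_point [set i | q_vec R i \in W].
Proof.
move=> rho0 [dW iW] fW; set B := [set i | _].
(* Both spaces have dimension [n], so one inclusion suffices; it is checked on the coordinate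
   vectors contained in [W]. *)
apply/eqP; rewrite eqEdim dim_fixed_point dW leqnn andbT.
apply/subvP => v vW; apply: mem_coordinates => j vj.
have ejW := torus_fixed_coordinates fW vW vj.
rewrite mem_fixed_point; case: (coordinateP j) ejW => [i qW|i pW|rW].
- by rewrite q_idx_fixed_coord inE.
- rewrite p_idx_fixed_coord inE; apply/negP => qW.
  have := iW _ _ qW pW; rewrite /Defs.form (bigD1 i)//= big1 => [|k ki].
    rewrite !mxE !idx_eq !eqxx /= !(mulr0, mul0r, addr0, mulr1) => /eqP.
    by rewrite oner_eq0.
  by rewrite !mxE !idx_eq (negbTE ki) !(mulr0, mul0r, addr0).
- have := iW _ _ rW rW; rewrite /Defs.form big1 => [|k _].
    by rewrite !mxE !eqxx add0r !mulr1 => /eqP; rewrite (negbTE rho0).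
  by rewrite !mxE !idx_eq !(mulr0, mul0r, addr0).
Qed.

(** The push-forward is a sum over a set of subspaces. The bijection [fixed_point] from the subsets
    of the index set onto this set turns it into an ordinary finite sum. *)
Lemma OG_integral_fixed_points rho (t : 'I_n -> R[i]) c : rho != 0 ->
  OG_integral rho t c =
  \sum_(B : {set 'I_n}) c (fixed_point B) / euler_class t (fixed_point B).
Proof.
move=> rho0; rewrite /OG_integral.
rewrite (reindex_fsbig fixed_point [set: {set 'I_n}]%classic).
  rewrite fsbig_finite//=; apply: perm_big; apply: uniq_perm.
  - exact: finmap.fset_uniq.
  - exact: index_enum_uniq.
  - move=> B; rewrite in_fset_set; last exact: finite_finset.
    by rewrite mem_index_enum; exact: in_setT.
split.
- by move=> B _; split; [exact: OG_fixed_point|exact: torus_fixed_point].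
- by move=> B C _ _; exact: fixed_point_inj.
- move=> W [OGW fW]; exists [set i | q_vec R i \in W] => //.
  by rewrite -(torus_fixed_OG rho0).
Qed.

Lemma chern_root_fixed_point (t : 'I_n -> R[i]) B i :
  chern_root t (fixed_point B) i = if i \in B then t i else - t i.
Proof. by rewrite /chern_root q_vec_fixed_point. Qed.

End FixedPoints.

(** * Summation over signed permutations *)

Lemma prod_lt_perm (F : comNzRingType) n (g : 'I_n -> 'I_n -> F) (s : 'S_n) :
  (forall i j, g i j = g j i) ->
  \prod_(i < n) \prod_(j < n | (i < j)%N) g (s i) (s j) =
  \prod_(i < n) \prod_(j < n | (i < j)%N) g i j.
Proof.
move=> gC; rewrite !pair_big_dep /=.
(* [h s] applies the permutation to a pair and sorts the result. It permutes the increasing pairs,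
   with inverse given by the inverse permutation, and the symmetry of [g] absorbs the sorting. *)
pose h (s : 'S_n) (p : 'I_n * 'I_n) :=
  if (s p.1 < s p.2)%N then (s p.1, s p.2) else (s p.2, s p.1).
have h1 (u : 'S_n) (p : 'I_n * 'I_n) : (p.1 < p.2)%N -> ((h u p).1 < (h u p).2)%N.
  move=> pp; rewrite /h; case: (ltnP (u p.1)) => //= us; rewrite ltn_neqAle us andbT.
  by rewrite (inj_eq val_inj) (inj_eq perm_inj) -(inj_eq val_inj) gtn_eqF.
have hK (u v : 'S_n) (p : 'I_n * 'I_n) : cancel u v -> (p.1 < p.2)%N -> h v (h u p) = p.
  move=> uv pp; rewrite /h; case: (ltnP (u p.1)) => _ /=; rewrite !uv.
    by rewrite pp -surjective_pairing.
  by rewrite ltnNge (ltnW pp) /= -surjective_pairing.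
rewrite [RHS](reindex_onto (h s) (h s^-1%g)) /=; last first.
  by move=> p pp; apply: hK => //; exact: permKV.
apply: eq_big => [p|p _]; last by rewrite /h; case: ifP => //=.
apply/idP/andP => [pp|[hp /eqP <-]]; last exact: h1.
by split; [exact: h1|rewrite (hK s) ?eqxx//; exact: permK].
Qed.

Lemma prod_neq_perm (F : comNzRingType) n (g : 'I_n -> 'I_n -> F) (s : 'S_n) :
  \prod_(i < n) \prod_(j < n | j != i) g (s i) (s j) =
  \prod_(i < n) \prod_(j < n | j != i) g i j.
Proof.
rewrite [RHS](reindex_inj (@perm_inj _ s)); apply: eq_bigr => i _.
rewrite [RHS](reindex_inj (@perm_inj _ s)); apply: eq_bigl => j.
by rewrite (inj_eq perm_inj).
Qed.

(** Each unordered pair occurs in both orders on the left. *)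
Lemma prod_neq_sqr (F : comNzRingType) n (g : 'I_n -> 'I_n -> F) :
  (forall i j, g i j = g j i) ->
  \prod_(i < n) \prod_(j < n | j != i) g i j =
  (\prod_(i < n) \prod_(j < n | (i < j)%N) g i j) ^+ 2.
Proof.
move=> gC; rewrite expr2.
have {2}-> : \prod_(i < n) \prod_(j < n | (i < j)%N) g i j =
    \prod_(i < n) \prod_(j < n | (j < i)%N) g i j.
  rewrite (exchange_big_dep predT)//=; apply: eq_bigr => i _.
  by apply: eq_bigr => j _.
rewrite -big_split; apply: eq_bigr => i _ /=.
rewrite (bigID (fun j : 'I_n => (i < j)%N)) /=; congr (_ * _); apply: eq_bigl => j.
  by rewrite -(inj_eq val_inj) neq_ltn orbC andb_orl; case: ltngtP.
by rewrite -(inj_eq val_inj) /=; case: ltngtP.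
Qed.

Lemma meval_perm (F : comNzRingType) n (V : mpoly n F) (s : 'S_n) (y : 'I_n -> F) :
  V \is @symmetric n F -> meval (fun i => y (s i)) V = meval y V.
Proof.
move=> /issymP hV; rewrite -[in RHS](hV s) mevalE /msym /mmap raddf_sum.
apply: eq_bigr => m _; rewrite /= mevalM mevalC rmorph_prod; congr (_ * _).
by apply: eq_bigr => i _; rewrite rmorphXn /= mevalXU.
Qed.

(** A tuple with distinct first components is a permutation with a sign at each position. Attaching
    the signs to the values [u j] rather than to the positions [j] makes the chosen roots, for a
    given [B], the same for all permutations up to order. *)
Lemma sum_perm_set (F : nmodType) n (E : n.-tuple ('I_n * bool) -> F) :
  (forall s, ~~ injectiveb (fun j => (tnth s j).1) -> E s = 0) ->
  \sum_s E s =
  \sum_(B : {set 'I_n}) \sum_(u : 'S_n) E [tuple (u j, u j \in B) | j < n].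
Proof.
move=> E0; rewrite (bigID (fun s => injectiveb (fun j => (tnth s j).1))) /=.
rewrite [X in _ + X]big1 ?addr0// pair_big /=.
pose h (q : {set 'I_n} * 'S_n) := [tuple (q.2 j, q.2 j \in q.1) | j < n].
pose p (s : n.-tuple ('I_n * bool)) : 'S_n :=
  (* The default value, the identity, is taken only when the first components are not distinct, a
     case outside the range of the reindexing. *)
  insubd (1%g : 'S_n) [ffun j => (tnth s j).1].
pose h' s := ([set k | (tnth s ((p s)^-1%g k)).2], p s).
have pE s : injectiveb (fun j => (tnth s j).1) -> forall j, p s j = (tnth s j).1.
  move=> /injectiveP inj j; rewrite -pvalE /p (val_insubd (1%g : {perm 'I_n})).
  case: ifP => [_|/negP[]]; first by rewrite ffunE.
  by apply/injectiveP => i k; rewrite !ffunE; exact: inj.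
rewrite (reindex h) /=.
  apply: eq_bigl => q; apply/injectiveP => i j.
  by rewrite !tnth_mktuple /=; exact: perm_inj.
have injh q : injectiveb (fun j => (tnth (h q) j).1).
  by apply/injectiveP => i j; rewrite !tnth_mktuple /=; exact: perm_inj.
exists h' => [[B u]|s /pE ps] /=.
  have pu : p (h (B, u)) = u by apply/permP => j; rewrite pE ?injh// tnth_mktuple.
  move=> _; rewrite /h' pu; congr pair.
  by apply/setP => k; rewrite inE tnth_mktuple /= permKV.
apply: eq_from_tnth => j; rewrite tnth_mktuple /= inE permK ps.
by rewrite -surjective_pairing.
Qed.

(** * From the sum over poles to the localization sum *)

Section SignedRootSum.
Variables (R : realType) (n : nat) (V : mpoly n R[i]) (t : 'I_n -> R[i]).
Hypotheses (hV : V \is @symmetric n R[i]) (ht : generic t).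

Definition residue_numerator (z : 'I_n -> R[i]) : R[i] :=
  (n`!)%:R^-1 *
  (meval z V * (\prod_(i < n) \prod_(j < n | j != i) (z j - z i))
   * (\prod_(i < n) \prod_(j < n | (i < j)%N) (z i + z j)) * 2 ^+ n).

(** These are the Chern roots at [fixed_point B], expressed as poles of the integrand. *)
Definition point_root (B : {set 'I_n}) (i : 'I_n) : R[i] :=
  signed_root t (i, i \in B).

Lemma residue_numerator_polynomial : separately_polynomial residue_numerator.
Proof.
have hX i := @separately_polynomial_proj R[i] n i.
apply: separately_polynomialM; first exact: separately_polynomial_cst.
apply: separately_polynomialM; last exact: separately_polynomial_cst.
apply: separately_polynomialM.
  apply: separately_polynomialM; first exact: separately_polynomial_meval.
  do 2 (apply: separately_polynomial_prod => ?).
  by apply: separately_polynomialD => //; exact: separately_polynomialN.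
do 2 (apply: separately_polynomial_prod => ?).
exact: separately_polynomialD.
Qed.

Lemma residue_numerator_eq0 (s : n.-tuple ('I_n * bool)) :
  ~~ injectiveb (fun j => (tnth s j).1) ->
  residue_numerator (fun j => signed_root t (tnth s j)) = 0.
Proof.
move=> /injectivePn[i [j ij sij]]; rewrite /residue_numerator.
(* The factors $z_i+z_j$ occur only for $i<j$, so the two positions sharing an index are put in
   order. *)
wlog lij : i j ij sij / (i < j)%N => [wl|].
  have := ij; rewrite -(inj_eq val_inj) neq_ltn => /orP[]; first exact: wl.
  by apply: wl => //; rewrite eq_sym.
have /eqP : signed_root t (tnth s j) ^+ 2 = signed_root t (tnth s i) ^+ 2.
  by rewrite !sqr_signed_root sij.
rewrite eqf_sqr => /orP[/eqP e|/eqP e].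
  rewrite (bigD1 i)//= (bigD1 j) 1?eq_sym//= e subrr.
  by rewrite !(mul0r, mulr0).
rewrite [X in _ * X * _](bigD1 i)//= [X in _ * (X * _) * _](bigD1 j)//= e subrr.
by rewrite !(mul0r, mulr0).
Qed.

Lemma point_root_neq0 B i : point_root B i != 0.
Proof. by rewrite /point_root /signed_root; case: ifP; rewrite ?oppr_eq0 (ht.1 i). Qed.

Lemma point_root_sqr_neq B i j : i != j -> point_root B i ^+ 2 != point_root B j ^+ 2.
Proof.
move=> ij; rewrite !sqr_signed_root /= eqf_sqr.
by have [n1 n2] := ht.2 _ _ ij; rewrite (negbTE n1) (negbTE n2).
Qed.

(** All factors are invariant under permuting the roots. The differences and $2^n$ cancel against
    the weights, and the product of sums, present once above and squared below, survives once
    below. *)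
Lemma residue_numerator_weight B (s : 'S_n) :
  residue_numerator (fun j => point_root B (s j)) *
    \prod_(j < n) root_weight t (s j, s j \in B) =
  (n`!)%:R^-1 * (meval (point_root B) V /
    ((\prod_(i < n) \prod_(j < n | (i < j)%N) (point_root B i + point_root B j))
     * \prod_(i < n) point_root B i)).
Proof.
rewrite /residue_numerator; set u := point_root B.
rewrite (meval_perm s u hV) (prod_neq_perm (fun i j => u j - u i)).
rewrite (@prod_lt_perm _ _ (fun i j => u i + u j)); last by move=> i j; rewrite addrC.
have -> : \prod_(j < n) root_weight t (s j, s j \in B) =
    \prod_(j < n) root_weight t (j, j \in B).
  by rewrite [RHS](reindex_inj (@perm_inj _ s)).
rewrite /root_weight prodfV !big_split /= prodr_const card_ord.
rewrite -[\prod_(i < n) signed_root t _]/(\prod_(i < n) u i).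
have -> : \prod_(k < n) \prod_(i < n | i != k) (t i ^+ 2 - t k ^+ 2) =
    \prod_(k < n) \prod_(i < n | i != k) (u i - u k) *
    (\prod_(i < n) \prod_(j < n | (i < j)%N) (u i + u j)) ^+ 2.
  rewrite -(@prod_neq_sqr _ _ (fun i j => u i + u j)); last by move=> i j; rewrite addrC.
  rewrite -big_split; apply: eq_bigr => k _ /=; rewrite -big_split /=.
  apply: eq_bigr => i _; rewrite -(sqr_signed_root t (i, i \in B)).
  by rewrite -(sqr_signed_root t (k, k \in B)) subr_sqr [u k + _]addrC.
have Q0 : \prod_(k < n) \prod_(i < n | i != k) (u i - u k) != 0.
  apply/prodf_neq0 => k _; apply/prodf_neq0 => i ik.
  by rewrite subr_eq0; apply: contra_neq (point_root_sqr_neq B ik) => e; rewrite -/u e.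
have S0 : \prod_(i < n) \prod_(j < n | (i < j)%N) (u i + u j) != 0.
  apply/prodf_neq0 => i _; apply/prodf_neq0 => j ij.
  rewrite addr_eq0; apply/eqP => e.
  have /point_root_sqr_neq : i != j by rewrite -(inj_eq val_inj) ltn_eqF.
  by move=> /(_ B); rewrite -/u e sqrrN eqxx.
have U0 : \prod_(i < n) u i != 0.
  by apply/prodf_neq0 => i _; exact: point_root_neq0.
have T0 : 2 ^+ n != 0 :> R[i] by rewrite expf_neq0// pnatr_eq0.
have N0 : n`!%:R != 0 :> R[i] by rewrite pnatr_eq0 -lt0n fact_gt0.
move: (\prod_(k < n) \prod_(i < n | i != k) _) Q0 => Q Q0.
move: (\prod_(k < n) \prod_(i < n | (k < i)%N) _) S0 => S S0.
move: (\prod_(k < n) u k) U0 => U U0.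
move: (2 ^+ n : R[i]) T0 (n`!%:R : R[i]) N0 (meval u V) => T T0 N N0 v.
field. by rewrite N0 S0 U0 T0 Q0.
Qed.

Lemma signed_root_sum :
  \sum_(s : n.-tuple ('I_n * bool))
     residue_numerator (fun j => signed_root t (tnth s j)) *
     \prod_(j < n) root_weight t (tnth s j) =
  \sum_(B : {set 'I_n}) meval (point_root B) V /
    ((\prod_(i < n) \prod_(j < n | (i < j)%N) (point_root B i + point_root B j))
     * \prod_(i < n) point_root B i).
Proof.
rewrite sum_perm_set => [|s ns]; last by rewrite residue_numerator_eq0// mul0r.
apply: eq_bigr => B _; transitivity (\sum_(s : 'S_n) (n`!)%:R^-1 *
    (meval (point_root B) V /
    ((\prod_(i < n) \prod_(j < n | (i < j)%N) (point_root B i + point_root B j))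
     * \prod_(i < n) point_root B i))).
  apply: eq_bigr => s _; rewrite -(residue_numerator_weight B s).
  congr (residue_numerator _ * _).
    by apply/funext => j; rewrite tnth_mktuple.
  by apply: eq_bigr => j _; rewrite tnth_mktuple.
(* The summand no longer depends on the permutation, so $n!$ equal terms cancel the factor
   $1/n!$. *)
rewrite sumr_const card_Sn -[LHS]mulr_natl [LHS]mulrA.
by rewrite divff ?mul1r// pnatr_eq0 -lt0n fact_gt0.
Qed.

End SignedRootSum.

(** * Comparison of the iterated residue with the push-forward *)

Theorem mainTheorem6 (R : realType) (n : nat) (rho : R[i]) (hrho : rho != 0)
    (V : mpoly n R[i]) (hV : V \is @symmetric n R[i])
    (t : 'I_n -> R[i]) (ht : generic t) :
  is_residue_at_infinity
    (fun z : 'I_n -> R[i] =>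
       (n`!)%:R^-1 *
       ((meval z V
         * (\prod_(i < n) \prod_(j < n | j != i) (z j - z i))
         * (\prod_(i < n) \prod_(j < n | (i < j)%N) (z i + z j))
         * 2 ^+ n)
        / \prod_(i < n) \prod_(j < n) ((t i - z j) * (t i + z j))))
    (OG_integral rho t (char_class V t)).
Proof.
rewrite OG_integral_fixed_points//.
have -> : \sum_(B : {set 'I_n}) char_class V t (fixed_point R B) /
      euler_class t (fixed_point R B) =
    \sum_(B : {set 'I_n}) meval (point_root t B) V /
    ((\prod_(i < n) \prod_(j < n | (i < j)%N) (point_root t B i + point_root t B j))
     * \prod_(i < n) point_root t B i).
  apply: eq_bigr => B _; rewrite /char_class /euler_class.
  rewrite (_ : chern_root t (fixed_point R B) = point_root t B)//.
  by apply/funext => i; rewrite chern_root_fixed_point.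
rewrite -(signed_root_sum hV ht).
rewrite (_ : (fun z => _) = (fun z => residue_numerator V z /
    \prod_(i < n) \prod_(j < n) ((t i - z j) * (t i + z j)))); last first.
  by apply/funext => z; rewrite /residue_numerator mulrA.
exact: is_residue_signed_roots ht _ (residue_numerator_polynomial V).
Qed.
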